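(* Let $\mathcal{H}$ be a finite-dimensional Hilbert space (over $\mathbb{R}$ or $\mathbb{C}$) and let $\Phi=\{\varphi_n\}_{n\in I}$, with $I$ countable, be a frame for $\mathcal{H}$ that does phase retrieval for $\mathcal{H}$. Then $\mathcal{A}_{\Phi}$ has a positive lower Lipschitz bound, i.e., there is a constant $C<\infty$ such that for every $f,g\in\mathcal{H}$ $$\inf_{|\alpha|=1}\|f-\alpha g\|\leq C\,\|\mathcal{A}_{\Phi}(f)-\mathcal{A}_{\Phi}(g)\|.$$
   Context: A countable family $\Phi=\{\varphi_n\}_{n\in I}\subseteq\mathcal{H}$ is a frame for $\mathcal{H}$ if there are constants $0<A\le B<\infty$ with $A\|f\|^2\leq\sum_{n\in I}|\langle f,\varphi_n\rangle|^2\leq B\|f\|^2$ for every $f\in\mathcal{H}$. The (nonlinear) map $\mathcal{A}_{\Phi}:\mathcal{H}\to\ell^2(I)$ is $\mathcal{A}_{\Phi}(f)=(|\langle f,\varphi_n\rangle|)_{n\in I}$. The norm of $\mathcal{A}_{\Phi}(f)-\mathcal{A}_{\Phi}(g)$ is the $\ell^2(I)$ norm. $\Phi$ does phase retrieval for $\mathcal{H}$ if, whenever $f,g\in\mathcal{H}$ satisfy $|\langle f,\varphi_n\rangle|=|\langle g,\varphi_n\rangle|$ for every $n\in I$, there is a scalar $\alpha$ with $|\alpha|=1$ and $f=\alpha g$. The infimum over $|\alpha|=1$ is over unimodular elements $\alpha$ of the scalar field of $\mathcal{H}$. *)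

(* Defs.v *)
From HB Require Import structures.
From mathcomp Require Import all_boot all_order all_algebra.
From mathcomp Require Import complex.
From mathcomp Require Import all_classical all_reals all_analysis.

Set Implicit Arguments.
Unset Strict Implicit.
Unset Printing Implicit Defensive.
Import Order.TTheory GRing.Theory Num.Theory.
Local Open Scope classical_set_scope.
Local Open Scope ring_scope.

Variant scalars := RealScalars | ComplexScalars.

Definition scalar_field (R : realType) (s : scalars) : numFieldType :=
  match s with
  | RealScalars => R
  | ComplexScalars => R[i]
  end.

Definition scalar_conj (R : realType) (s : scalars) :
    scalar_field R s -> scalar_field R s :=
  match s with
  | RealScalars => fun x => x
  | ComplexScalars => fun z => conjc z
  end.

Fact scalar_conj_zmod (R : realType) (s : scalars) :
  zmod_morphism (@scalar_conj R s).
Proof. by case: s => //= x y; rewrite rmorphB. Qed.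

Fact scalar_conj_monoid (R : realType) (s : scalars) :
  monoid_morphism (@scalar_conj R s).
Proof.
by case: s => //=; split; [rewrite rmorph1 | move=> x y; rewrite rmorphM].
Qed.

HB.instance Definition _ (R : realType) (s : scalars) :=
  GRing.isZmodMorphism.Build (scalar_field R s) (scalar_field R s)
    (@scalar_conj R s) (@scalar_conj_zmod R s).

HB.instance Definition _ (R : realType) (s : scalars) :=
  GRing.isMonoidMorphism.Build (scalar_field R s) (scalar_field R s)
    (@scalar_conj R s) (@scalar_conj_monoid R s).

Definition scalar_re (R : realType) (s : scalars) : scalar_field R s -> R :=
  match s with
  | RealScalars => fun x => x
  | ComplexScalars => fun z => complex.Re z
  end.

(* The norm `|z| of z : R[i] is an element of R[i] (with zero imaginary part);
   this is the corresponding element of R. *)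
Definition modulus (R : realType) (s : scalars) (z : scalar_field R s) : R :=
  scalar_re `|z|.

(* A finite-dimensional Hilbert space is a vectType over the scalars with a
   positive definite form, linear on the left and conjugate-linear on the right;
   completeness is automatic in finite dimension. *)
Definition hnorm (R : realType) (s : scalars)
    (H : vectType (scalar_field R s))
    (ip : {dot H for @scalar_conj R s}) (f : H) : R :=
  Num.sqrt (scalar_re (ip f f)).

Definition is_frame (R : realType) (s : scalars)
    (H : vectType (scalar_field R s))
    (ip : {dot H for @scalar_conj R s}) (I : countType) (phi : I -> H) : Prop :=
  exists A B : R, [/\ 0 < A, A <= B &
    forall f : H,
      ((A * hnorm ip f ^+ 2)%:E <=
         \esum_(n in [set: I]) (modulus (ip f (phi n)) ^+ 2)%:E <=
       (B * hnorm ip f ^+ 2)%:E)%E].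

Definition amplitude (R : realType) (s : scalars)
    (H : vectType (scalar_field R s))
    (ip : {dot H for @scalar_conj R s}) (I : countType) (phi : I -> H) (f : H) :
    I -> R :=
  fun n => modulus (ip f (phi n)).

Definition phase_retrieval (R : realType) (s : scalars)
    (H : vectType (scalar_field R s)) (ip : {dot H for @scalar_conj R s})
    (I : countType) (phi : I -> H) : Prop :=
  forall f g : H,
    (forall n : I, modulus (ip f (phi n)) = modulus (ip g (phi n))) ->
    exists alpha : scalar_field R s, modulus alpha = 1 /\ f = alpha *: g.

(* +oo when a is not square-summable *)
Definition l2norm (R : realType) (I : countType) (a : I -> R) : \bar R :=
  sqrte (\esum_(n in [set: I]) (`|a n| ^+ 2)%:E)%E.

Definition phase_dist (R : realType) (s : scalars)
    (H : vectType (scalar_field R s))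
    (ip : {dot H for @scalar_conj R s}) (f g : H) : R :=
  inf [set hnorm ip (f - alpha *: g) |
        alpha in [set alpha : scalar_field R s | modulus alpha = 1]].

(* Main.v *)
(* Replace g by alpha g so that <f, g> is real and nonnegative, and put u = f - g,
   v = f + g.  Then <u, v> is real, |f|, |g| <= |v|, and
   |<f, p>|^2 - |<g, p>|^2 = Re (<u, p> conj <v, p>) is real-bilinear in (u, v).
   Phase retrieval forbids this form from vanishing for every p = phi_n when u and
   v are nonzero and <u, v> is real, so compactness of the product of two unit
   spheres gives e > 0 and, for each such pair, one n with
   e |u| |v| <= | |<f, phi_n>| - |<g, phi_n>| | (|<f, phi_n>| + |<g, phi_n>|).
   The last factor is O(|v|) by the upper frame bound; cancelling |v| bounds
   |u| by a single coordinate of the amplitude difference. *)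
Require Import Defs.
From HB Require Import structures.
From mathcomp Require Import all_boot all_order all_algebra.
From mathcomp Require Import complex ring lra.
From mathcomp Require Import all_classical all_reals all_analysis.

Set Implicit Arguments.
Unset Strict Implicit.
Unset Printing Implicit Defensive.
Import Order.TTheory GRing.Theory Num.Theory.
Import numFieldNormedType.Exports.
Local Open Scope classical_set_scope.
Local Open Scope ring_scope.

(** * Real bilinear forms on row vectors, and a compactness bound *)

Section BilinearForms.
Context (R : realType) (m : nat).
Implicit Types (x y : 'rV[R]_m) (M : 'M[R]_m).

Definition bilin M x y : R := \sum_i \sum_j x 0 i * y 0 j * M i j.

Lemma bilinZ M a b x y : bilin M (a *: x) (b *: y) = a * b * bilin M x y.
Proof.
rewrite /bilin mulr_sumr; apply: eq_bigr => i _.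
rewrite mulr_sumr; apply: eq_bigr => j _.
by rewrite !mxE; ring.
Qed.

Lemma continuous_bilin M :
  continuous (fun p : 'rV[R]_m * 'rV[R]_m => bilin M p.1 p.2).
Proof.
suff sumC (F : 'I_m -> 'rV[R]_m * 'rV[R]_m -> R) :
    (forall i, continuous (F i)) -> continuous (fun p => \sum_i F i p).
  apply: (sumC (fun i p => _)) => i; apply: (sumC (fun j p => _)) => j p.
  apply: cvgMl; apply: cvgM.
    exact: (continuous_comp cvg_fst (@coord_continuous _ _ _ _ _ _)).
  exact: (continuous_comp cvg_snd (@coord_continuous _ _ _ _ _ _)).
move=> Fc; elim: (index_enum _) => [|i s IH].
  by under eq_fun do rewrite big_nil; exact: cst_continuous.
by under eq_fun do rewrite big_cons; move=> p; apply: cvgD; [exact: Fc|exact: IH].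
Qed.

Lemma norm_rV_coord x i : `|x 0 i| <= `|x|.
Proof.
rewrite [leRHS]/Num.Def.normr/= mx_normrE.
by apply/bigmax_geP; right; exists (0, i).
Qed.

Lemma bilin_le M x y : `|bilin M x y| <= `|x| * `|y| * \sum_i \sum_j `|M i j|.
Proof.
apply: le_trans (ler_norm_sum _ _ _) _; rewrite mulr_sumr; apply: ler_sum => i _.
apply: le_trans (ler_norm_sum _ _ _) _; rewrite mulr_sumr; apply: ler_sum => j _.
by rewrite !normrM ler_wpM2r ?ler_pM ?norm_rV_coord.
Qed.

(** The norm on row vectors is the sup norm of the coordinates, so this sphere is the boundary of a
    cube. *)
Lemma compact_unit_sphere : compact [set x : 'rV[R]_m | `|x| = 1].
Proof.
apply: bounded_closed_compact.
  by exists 1; split=> // M M1 x /= ->; exact: ltW.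
rewrite (_ : [set x | _] = (fun x : 'rV[R]_m => `|x|) @^-1` [set 1])//.
by apply: preimage_closed => // x _; exact: norm_continuous.
Qed.

(** Each point of the product of two unit spheres has a neighbourhood on which one [e] works, with
    an index [n] fixed there; compactness makes [e] uniform even when [I] is infinite. Homogeneity
    then removes the normalization. *)
Lemma bilin_bounded_below (I : Type) (N : I -> 'M[R]_m) M :
  (forall x y, x != 0 -> y != 0 -> bilin M x y = 0 ->
    exists n, bilin (N n) x y != 0) ->
  exists2 e, 0 < e & forall x y, x != 0 -> y != 0 -> bilin M x y = 0 ->
    exists n, e * (`|x| * `|y|) <= `|bilin (N n) x y|.
Proof.
move=> NM.
pose S := [set x : 'rV[R]_m | `|x| = 1] `*` [set x : 'rV[R]_m | `|x| = 1].
pose P e (p : 'rV[R]_m * 'rV[R]_m) := bilin M p.1 p.2 = 0 ->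
  exists n, e <= `|bilin (N n) p.1 p.2|.
have /compact_near_coveringP/(_ _ (0 : R)^'+ P) : compact S.
  by apply: compact_setX; exact: compact_unit_sphere.
have normC n : continuous (fun p : 'rV[R]_m * 'rV[R]_m => `|bilin n p.1 p.2|).
  by move=> p; apply: cvg_norm; exact: continuous_bilin.
have PS : forall p, S p -> \forall q \near p & e \near (0 : R)^'+, P e q.
  move=> [x y] [/= x1 y1].
  have x0 : x != 0 by rewrite -normr_gt0 x1.
  have y0 : y != 0 by rewrite -normr_gt0 y1.
  have [Mxy|Mxy] := eqVneq (bilin M x y) 0.
    have [n Nn] := NM x y x0 y0 Mxy.
    (* Halving the value at the point leaves a margin, so the same [n] serves all nearby pairs. *)
    set c := `|bilin (N n) x y|; have c0 : 0 < c by rewrite normr_gt0.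
    exists ([set q | c / 2 < `|bilin (N n) q.1 q.2|], [set e | e <= c / 2]).
      split=> /=; last by apply: nbhs_right_le; lra.
      apply: (normC (N n) (x, y) [set r | c / 2 < r]); apply: lt_nbhsr.
      by rewrite /= -/c; lra.
    by move=> [q e] [/= cq ec] _; exists n; apply: le_trans ec (ltW cq).
  (* Where [M] does not vanish it stays nonzero nearby, so [P e] holds vacuously there for every
     [e]. *)
  exists ([set q | 0 < `|bilin M q.1 q.2|], setT).
    split=> /=; last exact: filterT.
    apply: (normC M (x, y) [set r | 0 < r]); apply: lt_nbhsr.
    by rewrite /= normr_gt0.
  by move=> [q e] [/= Mq _] Mq0; move: Mq; rewrite Mq0 normr0 ltxx.
move=> /(_ _ PS) SP; near (0 : R)^'+ => e; exists e => // x y x0 y0 Mxy.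
have nx0 : `|x| != 0 by rewrite normr_eq0.
have ny0 : `|y| != 0 by rewrite normr_eq0.
have SPe : S `<=` P e by near: e.
have [||n Nn] := SPe (`|x|^-1 *: x, `|y|^-1 *: y).
- by split => /=; rewrite normrZ ger0_norm ?invr_ge0// mulVf.
- by rewrite /= bilinZ Mxy mulr0.
exists n; move: Nn; rewrite /= bilinZ normrM ger0_norm ?mulr_ge0 ?invr_ge0//.
by rewrite -invfM mulrC ler_pdivlMr// mulr_gt0// lt_def ?nx0 ?ny0/=.
Unshelve. all: by end_near. Qed.

End BilinearForms.

(** * Real and complex scalars treated uniformly *)

Definition scalar_of_real (R : realType) (s : scalars) : R -> scalar_field R s :=
  match s with
  | RealScalars => fun x => x
  | ComplexScalars => fun x => x%:C%C
  end.

(** Zero over the reals, so that the constraint that [ip u v] is real holds automatically in that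
    case. *)
Definition scalar_im (R : realType) (s : scalars) : scalar_field R s -> R :=
  match s with
  | RealScalars => fun=> 0
  | ComplexScalars => fun z => complex.Im z
  end.

Section Scalars.
Context (R : realType) (s : scalars).
Local Notation K := (scalar_field R s).
Local Notation conj := (@scalar_conj R s).
Implicit Types (a b : R) (z t : K).

Local Notation "a %:K" := (@scalar_of_real R s a) (at level 2, format "a %:K").

Lemma scalar_conj_real a : conj a%:K = a%:K.
Proof. by case: s => //=; rewrite oppr0. Qed.

Lemma scalar_reD z t : scalar_re (z + t) = scalar_re z + scalar_re t.
Proof. by case: s z t => //= -[? ?] [? ?]. Qed.

Lemma scalar_imD z t : scalar_im (z + t) = scalar_im z + scalar_im t.
Proof. by case: s z t => [? ?|[? ?] [? ?]] //=; rewrite addr0. Qed.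

Lemma scalar_reZ a z : scalar_re (a%:K * z) = a * scalar_re z.
Proof. by case: s z => //= -[? ?] /=; ring. Qed.

Lemma scalar_imZ a z : scalar_im (a%:K * z) = a * scalar_im z.
Proof. by case: s z => [?|[? ?]] /=; ring. Qed.

Lemma scalar_re_conj z : scalar_re (conj z) = scalar_re z.
Proof. by case: s z => //= -[]. Qed.

Lemma scalar_im_conj z : scalar_im (conj z) = - scalar_im z.
Proof. by case: s z => [?|[]] //=; rewrite oppr0. Qed.

Lemma scalar_conjK : involutive conj.
Proof. by case: s => //= -[? ?] /=; rewrite opprK. Qed.

Lemma scalar_conj_im0 z : scalar_im z = 0 -> conj z = z.
Proof. by case: s z => //= -[? ?] /= ->; rewrite oppr0. Qed.

Lemma scalar_re_gt0 z : 0 < z -> 0 < scalar_re z.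
Proof. by case: s z => //= -[? ?]; rewrite ltcE/= => /andP[]. Qed.

Lemma modulus_ge0 z : 0 <= modulus z.
Proof. by rewrite /modulus; case: s z => //= -[? ?] /=; exact: sqrtr_ge0. Qed.

Lemma scalar_norm z : `|z| = (modulus z)%:K.
Proof. by rewrite /modulus; case: s z => //= -[? ?]. Qed.

Lemma modulus_real a : modulus a%:K = `|a|.
Proof.
by rewrite /modulus; case: s => //=; rewrite expr0n addr0 sqrtr_sqr.
Qed.

Lemma modulusM z t : modulus (z * t) = modulus z * modulus t.
Proof. by rewrite {1}/modulus normrM (scalar_norm z) scalar_reZ. Qed.

Lemma scalar_mul_conj z : z * conj z = (modulus z ^+ 2)%:K.
Proof.
rewrite /modulus; case: s z => /= [x|[x y]].
  by rewrite real_normK// num_real.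
rewrite sqr_sqrtr ?addr_ge0 ?sqr_ge0//.
by apply/eqP; rewrite eq_complex /=; apply/andP; split; apply/eqP; ring.
Qed.

Lemma scalar_re_real a : scalar_re a%:K = a.
Proof. by case: s. Qed.

Lemma scalar_im_real a : scalar_im a%:K = 0.
Proof. by case: s. Qed.

Lemma scalar_of_real1 : 1%:K = 1.
Proof. by case: s. Qed.

Lemma scalar_of_realN1 : (-1)%:K = -1.
Proof. by case: s => //=; rewrite rmorphN1. Qed.

Lemma scalar_of_real_eq0 a : (a%:K == 0) = (a == 0).
Proof.
by case: s => //=; rewrite eq_complex/= eqxx andbT.
Qed.

Lemma scalar_of_realM a b : (a * b)%:K = a%:K * b%:K.
Proof. by case: s => //=; rewrite rmorphM. Qed.

(** For nonzero [z] the phase is [z] divided by its modulus. The conjugate falls on [alpha] because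
    it will multiply the second, conjugate-linear argument of [ip]. *)
Lemma exists_phase z : exists2 alpha : K, modulus alpha = 1 &
  conj alpha * z = (modulus z)%:K.
Proof.
have [->|z0] := eqVneq z 0.
  exists 1; first by rewrite /modulus normr1 -scalar_of_real1 scalar_re_real.
  by rewrite mulr0 /modulus normr0; apply/esym/eqP; rewrite scalar_of_real_eq0;
    case: s.
have r0 : modulus z != 0.
  by rewrite -scalar_of_real_eq0 -scalar_norm normr_eq0.
exists ((modulus z)^-1%:K * z).
  by rewrite modulusM modulus_real normfV ger0_norm ?modulus_ge0// mulVf.
rewrite rmorphM/= scalar_conj_real -mulrA (mulrC _ z) scalar_mul_conj.
by rewrite -scalar_of_realM expr2 mulKf.
Qed.

End Scalars.

(** * Restriction of scalars to the reals *)

Section RealCoordinates.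
Context (R : realType) (s : scalars) (H : vectType (scalar_field R s)).
Local Notation "a %:K" := (@scalar_of_real R s a) (at level 2, format "a %:K").

Definition real_comb m (w : 'I_m -> H) (x : 'rV[R]_m) : H :=
  \sum_i (x 0 i)%:K *: w i.

(** Over the complex field the polar forms and the real and imaginary parts of [ip] are bilinear for
    real scalars only. *)
Definition real_bilinear (b : H -> H -> R) :=
  [/\ forall u v t, b (u + v) t = b u t + b v t,
      forall a u t, b (a%:K *: u) t = a * b u t,
      forall t u v, b t (u + v) = b t u + b t v &
      forall a t u, b t (a%:K *: u) = a * b t u].

(** Expanding both arguments produces the Gram matrix of [b] on the family [w]; this moves the
    problem to row vectors. *)
Lemma real_bilinear_bilin b m (w : 'I_m -> H) x y : real_bilinear b ->
  b (real_comb w x) (real_comb w y) = bilin (\matrix_(i, j) b (w i) (w j)) x y.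
Proof.
move=> [bDl bZl bDr bZr].
have b0l t : b 0 t = 0 by apply: (addrI (b 0 t)); rewrite -bDl !addr0.
have b0r t : b t 0 = 0 by apply: (addrI (b t 0)); rewrite -bDr !addr0.
rewrite /bilin /real_comb (big_morph (b^~ _) (fun u v => bDl u v _) (b0l _)).
apply: eq_bigr => i _; rewrite bZl (big_morph (b _) (bDr _) (b0r _)) mulr_sumr.
by apply: eq_bigr => j _; rewrite bZr mulrA mxE.
Qed.

End RealCoordinates.

(** Over the reals a basis of [H] serves as it is; over the complex field the vectors [e i] are
    joined by the vectors ['i *: e i], doubling the dimension. *)
Lemma exists_real_basis (R : realType) (s : scalars)
    (H : vectType (scalar_field R s)) :
  exists m (w : 'I_m -> H),
    (forall f, exists x, f = real_comb w x) /\
    (forall x, real_comb w x = 0 -> x = 0).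
Proof.
have bE (f : H) : f = \sum_i coord (vbasis fullv) i f *: (vbasis fullv)`_i.
  by apply: coord_vbasis; exact: memvf.
have /freeP b0 : free (vbasis {:H}) := basis_free (vbasisP _).
case: s H bE b0 => H bE b0.
  exists (\dim {:H}), (fun i => (vbasis {:H})`_i); split=> [f|x].
    exists (\row_i coord (vbasis {:H}) i f).
    by rewrite {1}[f]bE; apply: eq_bigr => i _; rewrite mxE.
  by move=> /b0 x0; apply/rowP => i; rewrite mxE; exact: x0.
pose e i := (vbasis {:H})`_i.
pose w (k : 'I_(\dim {:H} + \dim {:H})) : H :=
  match fintype.split k with inl i => e i | inr i => 'i%C *: e i end.
have wE a b : real_comb w (row_mx a b) =
    \sum_i ((a 0 i)%:C + 'i * (b 0 i)%:C)%C *: e i.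
  rewrite /real_comb big_split_ord /= -big_split /=; apply: eq_bigr => i _.
  rewrite /w (unsplitK (inl _ i)) (unsplitK (inr _ i)) row_mxEl row_mxEr.
  by rewrite scalerA -scalerDl [X in _ + X]mulrC.
exists (\dim {:H} + \dim {:H})%N, w; split=> [f|x].
  exists (row_mx (\row_i complex.Re (coord (vbasis {:H}) i f))
                 (\row_i complex.Im (coord (vbasis {:H}) i f))).
  rewrite wE {1}[f]bE; apply: eq_bigr => i _.
  by rewrite !mxE -complexE.
rewrite -[x]hsubmxK wE => /b0 x0.
suff x00 : lsubmx x = 0 /\ rsubmx x = 0 by rewrite x00.1 x00.2 row_mx0.
split; apply/rowP => i; rewrite [RHS]mxE; have /eqP := x0 i;
  rewrite eq_complex /= => /andP[/eqP + /eqP];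
  by rewrite ?(mul0r, mul1r, mulr0, addr0, add0r, subr0).
Qed.

(** * Inner product, polar forms and phase alignment *)

Section Hilbert.
Context (R : realType) (s : scalars) (H : vectType (scalar_field R s)).
Variable ip : {dot H for @scalar_conj R s}.
Local Notation K := (scalar_field R s).
Local Notation conj := (@scalar_conj R s).
Local Notation "a %:K" := (@scalar_of_real R s a) (at level 2, format "a %:K").
Implicit Types (f g u v p : H).

Lemma ipC u v : conj (ip u v) = ip v u.
Proof. by rewrite [ip v u]hermC expr0 mul1r. Qed.

Lemma ipDl u v p : ip (u + v) p = ip u p + ip v p.
Proof. exact: linearDl. Qed.

Lemma ipBl u v p : ip (u - v) p = ip u p - ip v p.
Proof. exact: linearBl. Qed.

Lemma ipDr u v p : ip p (u + v) = ip p u + ip p v.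
Proof. exact: linearDr. Qed.

Lemma ipZl (a : K) u v : ip (a *: u) v = a * ip u v.
Proof. exact: linearZl_LR. Qed.

Lemma ipZr (a : K) u v : ip u (a *: v) = conj a * ip u v.
Proof. exact: linearZr_LR. Qed.

Lemma ip_im0 u : scalar_im (ip u u) = 0.
Proof.
have : scalar_im (ip u u) = - scalar_im (ip u u) by rewrite -scalar_im_conj ipC.
lra.
Qed.

Lemma ip_re_ge0 u : 0 <= scalar_re (ip u u).
Proof.
have [->|u0] := eqVneq u 0; first by rewrite linear0l; case: s.
by apply/ltW/scalar_re_gt0; exact: neq0_dnorm_gt0.
Qed.

Lemma hnorm_sqr u : hnorm ip u ^+ 2 = scalar_re (ip u u).
Proof. by rewrite sqr_sqrtr ?ip_re_ge0. Qed.

Lemma hnorm_ge0 u : 0 <= hnorm ip u.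
Proof. exact: sqrtr_ge0. Qed.

Lemma hnorm_eq0 u : hnorm ip u = 0 -> u = 0.
Proof.
move=> u0; have [//|u1] := eqVneq u 0.
have /scalar_re_gt0 : 0 < ip u u by exact: neq0_dnorm_gt0.
by rewrite -hnorm_sqr u0 expr0n ltxx.
Qed.

Lemma real_bilinear_re_ip : real_bilinear (fun u v => scalar_re (ip u v)).
Proof.
split=> *; rewrite ?ipDl ?ipDr ?scalar_reD//.
  by rewrite ipZl scalar_reZ.
by rewrite ipZr /= scalar_conj_real scalar_reZ.
Qed.

Lemma real_bilinear_im_ip : real_bilinear (fun u v => scalar_im (ip u v)).
Proof.
split=> *; rewrite ?ipDl ?ipDr ?scalar_imD//.
  by rewrite ipZl scalar_imZ.
by rewrite ipZr /= scalar_conj_real scalar_imZ.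
Qed.

(** The symmetric real-bilinear form that polarizes the quadratic form sending [u] to
    [modulus (ip u p) ^+ 2]. *)
Definition polar_form p u v : R := scalar_re (ip u p * conj (ip v p)).

Lemma real_bilinear_polar_form p : real_bilinear (polar_form p).
Proof.
rewrite /polar_form; split=> *; rewrite ?ipDl ?ipZl ?(rmorphD, rmorphM) /=.
- by rewrite mulrDl scalar_reD.
- by rewrite -mulrA scalar_reZ.
- by rewrite mulrDr scalar_reD.
- by rewrite scalar_conj_real mulrCA scalar_reZ.
Qed.

(** The two cross terms are conjugate to each other and enter with opposite signs, so their real
    parts cancel. *)
Lemma polar_formE p f g :
  polar_form p (f - g) (f + g) = modulus (ip f p) ^+ 2 - modulus (ip g p) ^+ 2.
Proof.
rewrite /polar_form ipBl ipDl rmorphD /=.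
set a := ip f p; set b := ip g p.
have -> : (a - b) * (conj a + conj b) =
    a * conj a + a * conj b + (-1)%:K * (b * conj a + b * conj b).
  by rewrite scalar_of_realN1; ring.
rewrite scalar_reD scalar_reZ !scalar_reD !scalar_mul_conj !scalar_re_real.
have -> : scalar_re (b * conj a) = scalar_re (a * conj b).
  by rewrite -scalar_re_conj rmorphM /= scalar_conjK mulrC.
ring.
Qed.

Lemma phase_alignment f g : exists2 alpha : K, modulus alpha = 1 &
  scalar_im (ip f (alpha *: g)) = 0 /\ 0 <= scalar_re (ip f (alpha *: g)).
Proof.
have [alpha alpha1 E] := exists_phase (ip f g); exists alpha => //.
rewrite ipZr /= E scalar_re_real scalar_im_real; split=> //; exact: modulus_ge0.
Qed.

(** The diagonal terms are real, and [ip f g - ip g f] is twice the imaginary part of [ip f g],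
    times the imaginary unit. *)
Lemma aligned_im_eq0 f g : scalar_im (ip f g) = 0 ->
  scalar_im (ip (f - g) (f + g)) = 0.
Proof.
move=> fg0; rewrite ipBl !ipDr -mulN1r -(scalar_of_realN1 R s).
rewrite scalar_imD scalar_imZ !scalar_imD.
by rewrite !ip_im0 -(ipC f g) scalar_im_conj fg0; ring.
Qed.

Lemma aligned_hnorm f g : 0 <= scalar_re (ip f g) ->
  hnorm ip f ^+ 2 + hnorm ip g ^+ 2 <= hnorm ip (f + g) ^+ 2.
Proof.
move=> fg0; rewrite !hnorm_sqr ipDl !ipDr !scalar_reD.
by rewrite -(ipC f g) scalar_re_conj; lra.
Qed.

Lemma phase_dist_le f g alpha : modulus alpha = 1 ->
  phase_dist ip f g <= hnorm ip (f - alpha *: g).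
Proof.
move=> alpha1; apply: ge_inf; last by exists alpha.
by exists 0 => _ [beta _ <-]; exact: hnorm_ge0.
Qed.

(* If every polar form vanished at (u, v), then u + v and v - u would have equal
   amplitudes, hence u + v = alpha (v - u); pairing with v and conjugating, as
   <u, v> and <v, v> are real, forces alpha = 1 and then u = 0. *)
Lemma phase_retrieval_polar_form (I : countType) (phi : I -> H) u v :
  phase_retrieval ip phi -> u != 0 -> v != 0 -> scalar_im (ip u v) = 0 ->
  exists n, polar_form (phi n) u v != 0.
Proof.
move=> pr u0 v0 uv0; apply: contrapT => /forallNP polar0.
have [|alpha [alpha1 fg]] := pr (u + v) (v - u).
  move=> n; apply/eqP; rewrite -(@eqrXn2 _ 2)// ?modulus_ge0//.
  (* The difference and the sum of [u + v] and [v - u] are [2u] and [2v], so the form takes four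
     times its value at [(u, v)]. *)
  rewrite -subr_eq0 -polar_formE.
  have /negP/negPn/eqP p0 := polar0 n.
  have [bDl bZl bDr bZr] := real_bilinear_polar_form (phi n).
  have -> : u + v - (v - u) = u + u by rewrite opprB addrACA subrr addr0.
  have -> : u + v + (v - u) = v + v by rewrite [u + v]addrC addrACA subrr addr0.
  by rewrite bDl !bDr p0 !addr0.
set d := ip v v; set c := ip u v.
have E1 : c + d = alpha * (d - c).
  by rewrite /c /d -ipDl fg ipZl ipBl.
have E2 : alpha * (c + d) = d - c.
  have := congr1 conj E1; rewrite rmorphM rmorphB rmorphD /=.
  rewrite (scalar_conj_im0 (ip_im0 v)) (scalar_conj_im0 uv0) => ->.
  by rewrite mulrA scalar_mul_conj alpha1 expr1n scalar_of_real1 mul1r.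
(* Combining [E1] and [E2] eliminates [c]; since [d] is positive, [alpha] must be 1. *)
have /eqP : (1 - alpha) * (d *+ 2) = 0.
  have -> : (1 - alpha) * (d *+ 2) =
      c + d - alpha * (d - c) - (alpha * (c + d) - (d - c)) by ring.
  by rewrite -E1 E2 !subrr.
rewrite mulf_eq0 mulrn_eq0 /= (gt_eqF (neq0_dnorm_gt0 v v0)) orbF subr_eq0.
move=> /eqP a1; move: fg; rewrite -a1 scale1r [u + v]addrC => /addrI/eqP.
rewrite -subr_eq0 opprK -mulr2n -scaler_nat scaler_eq0 pnatr_eq0 /=; exact/negP.
Qed.

End Hilbert.

(** * Single coordinates against sums over the index set *)

Lemma le_esum_term (R : realType) (I : countType) (a : I -> R) n :
  (forall k, 0 <= a k) -> ((a n)%:E <= \esum_(k in [set: I]) (a k)%:E)%E.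
Proof.
move=> a0; apply: esum_ge; exists [set n]; first by split.
by rewrite fsbig_set1.
Qed.

Lemma le_l2norm (R : realType) (I : countType) (a : I -> R) n :
  (`|a n|%:E <= l2norm a)%E.
Proof.
have -> : `|a n|%:E = sqrte (`|a n| ^+ 2)%:E by rewrite /= sqrtr_sqr normr_id.
rewrite lee_sqrt.
  by apply: (@le_esum_term _ _ (fun k => `|a k| ^+ 2)) => k; exact: sqr_ge0.
by apply: esum_ge0 => k _; rewrite lee_fin sqr_ge0.
Qed.

(** * The lower Lipschitz bound *)

Section LowerBound.
Context (R : realType) (s : scalars) (H : vectType (scalar_field R s)).
Variables (ip : {dot H for @scalar_conj R s}) (I : countType) (phi : I -> H).

(** One term of the frame sum is at most the whole sum, so the square root of the upper frame bound
    works. *)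
Lemma frame_modulus_le : is_frame ip phi ->
  exists2 B : R, 0 <= B & forall f n, modulus (ip f (phi n)) <= B * hnorm ip f.
Proof.
move=> [A [B [A0 AB fr]]]; exists (Num.sqrt B) => [|f n]; first exact: sqrtr_ge0.
have /andP[_ frB] := fr f.
have := le_trans (@le_esum_term _ _ (fun k => modulus (ip f (phi k)) ^+ 2) n
  (fun k => sqr_ge0 _)) frB.
rewrite lee_fin => le2; rewrite -(ler_pXn2r (ltn0Sn 1)) ?nnegrE ?modulus_ge0//.
  by rewrite exprMn sqr_sqrtr//; lra.
by rewrite mulr_ge0 ?sqrtr_ge0 ?hnorm_ge0.
Qed.

(** Positivity of the distance makes [f - alpha *: g] nonzero for the aligning phase. It also
    ensures that an index exists: [I] may be empty when [H] is the zero space. *)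
Lemma amplitude_lower_bound : is_frame ip phi -> phase_retrieval ip phi ->
  exists2 C : R, 0 <= C & forall f g, 0 < phase_dist ip f g -> exists n,
    phase_dist ip f g <= C * `|amplitude ip phi f n - amplitude ip phi g n|.
Proof.
move=> /frame_modulus_le[B B0 leB] pr.
have [m [w [wspan wfree]]] := exists_real_basis H.
pose mx b : 'M[R]_m := \matrix_(i, j) b (w i) (w j).
have [|e e0 lower] := @bilin_bounded_below R m I
    (fun n => mx (polar_form ip (phi n))) (mx (fun u v => scalar_im (ip u v))).
  move=> x y x0 y0.
  rewrite -real_bilinear_bilin; last exact: real_bilinear_im_ip.
  move=> /(phase_retrieval_polar_form pr)[||n].
  - by apply: contra_neq x0; exact: wfree.
  - by apply: contra_neq y0; exact: wfree.
  rewrite real_bilinear_bilin; last exact: real_bilinear_polar_form.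
  by exists n.
(* [D] compares [hnorm] with the sup norm of real coordinates: its square is the sum of the absolute
   values of the Gram entries. *)
have [D D0 leD] : exists2 D : R, 0 <= D &
    forall x, hnorm ip (real_comb w x) <= D * `|x|.
  pose M := mx (fun u v => scalar_re (ip u v)).
  have M0 : 0 <= \sum_i \sum_j `|M i j|.
    by apply: sumr_ge0 => i _; apply: sumr_ge0.
  exists (Num.sqrt (\sum_i \sum_j `|M i j|)) => [|x]; first exact: sqrtr_ge0.
  rewrite -(ler_pXn2r (ltn0Sn 1)) ?nnegrE ?hnorm_ge0 ?mulr_ge0 ?sqrtr_ge0//.
  rewrite hnorm_sqr (real_bilinear_bilin _ _ _ (real_bilinear_re_ip ip)).
  apply: le_trans (ler_norm _) _; apply: le_trans (bilin_le _ _ _) _.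
  by rewrite exprMn sqr_sqrtr// mulrC expr2.
(* The outer [D] bounds [hnorm] of [f - g'] by [|x|]; [2 * B * D] bounds the sum of the two moduli
   relative to [|y|]; [e] is the compactness constant. *)
exists (D * (2 * B * D / e)) => [|f g dist0].
  by rewrite !mulr_ge0 ?invr_ge0// ltW.
have [alpha alpha1 [im0 re0]] := phase_alignment ip f g.
set g' := alpha *: g in im0 re0.
have distu : phase_dist ip f g <= hnorm ip (f - g') by exact: phase_dist_le.
have [x ux] := wspan (f - g'); have [y vy] := wspan (f + g').
have u0 : 0 < hnorm ip (f - g') by exact: lt_le_trans distu.
have hn0 := hnorm_ge0 ip; have fgv := aligned_hnorm re0.
have fv : hnorm ip f <= hnorm ip (f + g').
  rewrite -(ler_pXn2r (ltn0Sn 1)) ?nnegrE//.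
  by apply: le_trans fgv; rewrite lerDl sqr_ge0.
have gv : hnorm ip g' <= hnorm ip (f + g').
  rewrite -(ler_pXn2r (ltn0Sn 1)) ?nnegrE//.
  by apply: le_trans fgv; rewrite lerDr sqr_ge0.
have x0 : x != 0.
  apply: contraTneq u0 => x0.
  by rewrite ux -leNgt (le_trans (leD _))// x0 normr0 mulr0.
(* If [f + g'] vanished, alignment would force [f] and [g'] to vanish, hence also their
   difference. *)
have y0 : y != 0.
  apply: contraTneq u0 => y0; rewrite -leNgt.
  have v0 : hnorm ip (f + g') <= 0.
    by rewrite vy (le_trans (leD _))// y0 normr0 mulr0.
  have f0 : f = 0.
    by apply: (@hnorm_eq0 _ _ _ ip); apply/le_anti; rewrite (le_trans fv v0) hn0.
  have g0 : g' = 0.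
    by apply: (@hnorm_eq0 _ _ _ ip); apply/le_anti; rewrite (le_trans gv v0) hn0.
  by move: v0; rewrite f0 g0 subr0 addr0.
have [|n] := lower x y x0 y0.
  rewrite -(real_bilinear_bilin _ _ _ (real_bilinear_im_ip ip)) -ux -vy.
  exact: aligned_im_eq0.
rewrite -(real_bilinear_bilin _ _ _ (real_bilinear_polar_form ip (phi n))).
rewrite -ux -vy polar_formE => lown; exists n.
rewrite /amplitude.
have -> : modulus (ip g (phi n)) = modulus (ip g' (phi n)).
  by rewrite ipZl modulusM alpha1 mul1r.
move: lown; set a := modulus _; set b := modulus _ => lown.
have ab0 : 0 <= a + b by rewrite addr_ge0 ?modulus_ge0.
have abB : a + b <= 2 * B * D * `|y|.
  have leBv h : hnorm ip h <= hnorm ip (f + g') ->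
      modulus (ip h (phi n)) <= B * (D * `|y|).
    move=> hv; apply: le_trans (leB _ _) _; rewrite ler_wpM2l//.
    by apply: le_trans hv _; rewrite vy.
  have := leBv f fv; have := leBv g' gv; rewrite -/a -/b; lra.
have ny : 0 < `|y| by rewrite normr_gt0.
(* [lown] bounds [e * (|x| * |y|)] by [|a - b| * (a + b)]; inserting [abB] lets the factor [|y|]
   cancel. *)
have : e * `|x| <= `|a - b| * (2 * B * D).
  rewrite -(ler_pM2r ny) -!mulrA; apply: le_trans lown _.
  by rewrite subr_sqr normrM (ger0_norm ab0) ler_wpM2l// !mulrA.
rewrite mulrC -ler_pdivlMr// => lex.
apply: le_trans distu _; rewrite ux; apply: le_trans (leD _) _.
rewrite -mulrA ler_wpM2l//; apply: le_trans lex _.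
by rewrite le_eqVlt; apply/orP; left; apply/eqP; ring.
Qed.

End LowerBound.

Theorem proposition1p4 (R : realType) (s : scalars)
    (H : vectType (scalar_field R s))
    (ip : {dot H for @scalar_conj R s}) (I : countType) (phi : I -> H) :
  is_frame ip phi ->
  phase_retrieval ip phi ->
  exists C : R, forall f g : H,
    ((phase_dist ip f g)%:E <=
       C%:E * l2norm (amplitude ip phi f \- amplitude ip phi g)%R)%E.
Proof.
move=> fr pr; have [C C0 dist_le] := amplitude_lower_bound fr pr.
(* At distance zero it suffices that the right side is nonnegative, possibly infinite; otherwise a
   single coordinate of the difference already gives the bound. *)
exists C => f g; have [dist0|/dist_le[n fgn]] := leP (phase_dist ip f g) 0.
  by apply: (@le_trans _ _ 0%E); rewrite ?lee_fin// mule_ge0 ?lee_fin ?sqrte_ge0.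
apply: (@le_trans _ _
  (C%:E * `|amplitude ip phi f n - amplitude ip phi g n|%:E)%E).
  by rewrite -EFinM lee_fin.
by rewrite lee_wpmul2l ?lee_fin//; exact: (@le_l2norm _ _ (_ \- _)).
Qed.
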